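(* Let $p,l,M,d\ge 1$ be integers, let $r_0=l$, $r_d=1$, and let $r_1,\dots,r_{d-1}\ge 1$ be integers. Let $\boldsymbol{\mathcal{V}}^{(i)}\in\mathbb{R}^{r_{i-1}\times(pM+1)\times r_i}$, $i=1,\dots,d$, be 3-way real tensors (the TN-cores). Suppose the outputs $\boldsymbol{y}(t)=(y_1(t),\dots,y_l(t))^T\in\mathbb{R}^l$ are described by the MIMO Volterra system $$\boldsymbol{y}(t)=(\boldsymbol{\mathcal{V}}^{(1)}\times_2\boldsymbol{u}_t^T)\,(\boldsymbol{\mathcal{V}}^{(2)}\times_2\boldsymbol{u}_t^T)\cdots(\boldsymbol{\mathcal{V}}^{(d)}\times_2\boldsymbol{u}_t^T),$$ where $\boldsymbol{u}_t\in\mathbb{R}^{pM+1}$ is the input vector at time $t$. For $1\le k\le d$ set $$\boldsymbol{v}_{k-1}:=(\boldsymbol{\mathcal{V}}^{(1)}\times_2\boldsymbol{u}_t^T)\cdots(\boldsymbol{\mathcal{V}}^{(k-1)}\times_2\boldsymbol{u}_t^T)\in\mathbb{R}^{l\times r_{k-1}},$$ $$\boldsymbol{v}_{k+1}:=(\boldsymbol{\mathcal{V}}^{(k+1)}\times_2\boldsymbol{u}_t^T)\cdots(\boldsymbol{\mathcal{V}}^{(d)}\times_2\boldsymbol{u}_t^T)\in\mathbb{R}^{r_k\times 1}.$$ Then $$\boldsymbol{y}(t)=\big(\boldsymbol{v}_{k+1}^T\otimes\boldsymbol{u}_t^T\otimes\boldsymbol{v}_{k-1}\big)\,\mathrm{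vec}(\boldsymbol{\mathcal{V}}^{(k)}).$$
   Context: The input vector is $$\boldsymbol{u}_t=\big(1,u_1(t),\dots,u_p(t),u_1(t-1),\dots,u_p(t-1),\dots,u_1(t-M+1),\dots,u_p(t-M+1)\big)^T\in\mathbb{R}^{pM+1},$$ where $u_1,\dots,u_p$ are real-valued discrete-time input signals, $p$ is the number of inputs, $l$ the number of outputs, $M$ the memory and $d$ the degree. For a 3-way tensor $\boldsymbol{\mathcal{A}}\in\mathbb{R}^{a\times n\times b}$ and $\boldsymbol{x}\in\mathbb{R}^n$, the 2-mode product $\boldsymbol{\mathcal{A}}\times_2\boldsymbol{x}^T$ is the $a\times 1\times b$ tensor, identified with an $a\times b$ matrix, with entries $\sum_{i=1}^n x_i\,\boldsymbol{\mathcal{A}}_{\alpha i\beta}$. Juxtaposition of such factors is matrix multiplication. An empty product is the identity matrix: for $k=1$, $\boldsymbol{v}_{0}=\boldsymbol{I}_l$, and for $k=d$, $\boldsymbol{v}_{d+1}=1$. $\otimes$ is the Kronecker product: $\boldsymbol{B}\otimes\boldsymbol{C}$ is the block matrix whose $(i,j)$ block is $b_{ij}\boldsymbol{C}$. The vectorization $\mathrm{vec}(\boldsymbol{\mathcal{A}})$ of a tensor lists all its entries in one column vector in column-major (Matlab) order, i.e. the first index varies fastest and the last index slowest. *)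

(* Defs.v *)
From mathcomp Require Import all_boot all_order all_algebra.
From mathcomp Require Import reals.
From mathcomp Require Export mxtens.

Set Implicit Arguments.
Unset Strict Implicit.
Unset Printing Implicit Defensive.

Import GRing.Theory.
Local Open Scope ring_scope.

Notation "B *t C" := (tensmx B C)
  (at level 40, left associativity, format "B  *t  C") : ring_scope.

Section Tensors.

Variable R : realType.

Definition tensor3 (a n b : nat) := {ffun 'I_a * 'I_n * 'I_b -> R}.

(* The a x 1 x b tensor A x_2 w, for a row vector w, as an a x b matrix. *)
Definition mode2 (a n b : nat) (A : tensor3 a n b) (w : 'rV[R]_n) :
    'M[R]_(a, b) :=
  \matrix_(i, j) \sum_(h < n) w 0 h * A (i, h, j).

(* Since (mxtens_unindex q).1 = q %/ a and (mxtens_unindex q).2 = q %% a on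
   'I_(_ * a), the (0-based) entry A (i, h, j) sits at row (j * n + h) * a + i:
   the first index varies fastest. *)
Definition vec (a n b : nat) (A : tensor3 a n b) : 'cV[R]_(b * n * a) :=
  \col_q let jh := mxtens_unindex (mxtens_unindex q).1 in
         A ((mxtens_unindex q).2, jh.2, jh.1).

(* The leading 1, followed by u_j(t - m) at (0-based) row 1 + m * p + j, for
   m < M and j < p (j is the 0-based number of the input). *)
Definition input_vector (p M : nat) (u : 'I_p -> int -> R) (t : int) :
    'cV[R]_(1 + M * p) :=
  col_mx (const_mx 1)
    (\col_q let mj := mxtens_unindex q in u mj.2 (t - (mj.1 : nat)%:Z)).

Section CoreProducts.

(* The cores V 1, V 2, ... have the ranks r 0, r 1, ...; a network of degree d
   uses only V 1, ..., V d and r 0, ..., r d, so V 0 is a dummy. *)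
Variables (n : nat) (r : nat -> nat).
Variable V : forall i : nat, tensor3 (r i.-1) n (r i).
Variable w : 'rV[R]_n.

(* (V (a + 1) x_2 w) ... (V (a + m) x_2 w) *)
Fixpoint core_prod_len (a m : nat) : 'M[R]_(r a, r (m + a)) :=
  match m return 'M[R]_(r a, r (m + a)) with
  | 0 => 1%:M
  | m'.+1 => core_prod_len a m' *m mode2 (V (m' + a).+1) w
  end.

(* (V (a + 1) x_2 w) ... (V b x_2 w), the identity matrix if a = b *)
Definition core_prod (a b : nat) (hab : (a <= b)%N) : 'M[R]_(r a, r b) :=
  castmx (erefl (r a), congr1 r (subnK hab)) (core_prod_len a (b - a)).

End CoreProducts.

End Tensors.

Lemma mul11n (l : nat) : (1 * 1 * l)%N = l.
Proof. by rewrite !mul1n. Qed.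

(* Main.v *)
(** Splitting the product of the factors at the [k]-th core gives
    [y = v_(k-1) (V^(k) x_2 u^T) v_(k+1)], which is linear in the entries of
    [V^(k)]; the coefficient of [V^(k) (i, h, j)] in row [s] is
    [v_(k+1) j * u h * v_(k-1) s i], an entry of the Kronecker product. *)
Require Import Defs.
From mathcomp Require Import all_boot all_order all_algebra.
From mathcomp Require Import reals.

Set Implicit Arguments.
Unset Strict Implicit.
Unset Printing Implicit Defensive.

Import GRing.Theory.
Local Open Scope ring_scope.

Section CoreProducts.

Variables (R : realType) (n : nat) (r : nat -> nat).
Variables (V : forall i : nat, tensor3 R (r i.-1) n (r i)) (w : 'rV[R]_n).

(** The subtraction [b - a] does not compute for variables. Freeing the length [m] and the proof [e]
    lets one substitute [m + a] for [b] and take [e := erefl], which makes the cast trivial. *)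
Lemma core_prodE (a b m : nat) (hab : (a <= b)%N) (e : (m + a)%N = b) :
  core_prod V w hab =
    castmx (erefl (r a), congr1 r e) (core_prod_len V w a m).
Proof.
have em : m = (b - a)%N by rewrite -e addnK.
by subst m; rewrite /core_prod (eq_irrelevance (subnK hab) e).
Qed.

Lemma core_prod_id (a : nat) (haa : (a <= a)%N) : core_prod V w haa = 1%:M.
Proof. by rewrite (@core_prodE _ _ 0 haa erefl) castmx_id. Qed.

Lemma core_prod_recr (a b : nat) (hab : (a <= b)%N) (habS : (a <= b.+1)%N) :
  core_prod V w habS = core_prod V w hab *m mode2 (V b.+1) w.
Proof.
have [m e] : {m | (m + a)%N = b} by exists (b - a)%N; rewrite subnK.
subst b; rewrite (@core_prodE _ _ m hab erefl).
by rewrite (@core_prodE _ _ m.+1 habS erefl) !castmx_id.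
Qed.

(** Induction on [c]: as long as [b <= c], the factor [c.+1] is peeled off on the right and
    associativity applies; once [b] reaches the upper end, the second product is empty. *)
Lemma core_prod_cat (a b c : nat) (hab : (a <= b)%N) (hbc : (b <= c)%N)
    (hac : (a <= c)%N) :
  core_prod V w hac = core_prod V w hab *m core_prod V w hbc.
Proof.
elim: c => [|c IHc] in hbc hac *.
  have eb : b = 0%N by apply/eqP; rewrite -leqn0.
  subst b; rewrite core_prod_id mulmx1.
  by rewrite (eq_irrelevance hac hab).
have [hbc' | ltcb] := leqP b c.
  have hac' := leq_trans hab hbc'.
  by rewrite (core_prod_recr hac') (core_prod_recr hbc') mulmxA -IHc.
have eb : b = c.+1 by apply/eqP; rewrite eqn_leq hbc.
subst b; rewrite core_prod_id mulmx1.
by rewrite (eq_irrelevance hac hab).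
Qed.

End CoreProducts.

Lemma castmx_mulr (R : pzSemiRingType) (m n q q' : nat) (e : q = q')
    (A : 'M[R]_(m, n)) (B : 'M[R]_(n, q)) :
  castmx (erefl m, e) (A *m B) = A *m castmx (erefl n, e) B.
Proof. by case: q' / e; rewrite !castmx_id. Qed.

Lemma sum_mxtens_index (W : nmodType) (m n : nat) (F : 'I_(m * n) -> W) :
  \sum_q F q = \sum_(i < m) \sum_(j < n) F (mxtens_index (i, j)).
Proof.
rewrite pair_bigA (reindex (@mxtens_index m n)) /=.
  by apply: eq_bigr => -[i j] _.
by exists (@mxtens_unindex m n) => q _; rewrite ?mxtens_indexK ?mxtens_unindexK.
Qed.

(** The Kronecker factors stand in the order of the indices in [vec], slowest first, so column and
    entry decode to the same triple [(j, h, i)]. *)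
Lemma tens_mul_vec (R : realType) (l a n b : nat) (A : tensor3 R a n b)
    (x : 'rV[R]_n) (B : 'M[R]_(l, a)) (C : 'cV[R]_b) :
  castmx (mul11n l, erefl 1%N) ((C^T *t x *t B) *m vec A) =
    B *m mode2 A x *m C.
Proof.
apply/matrixP => s o; rewrite castmxE !mxE /=.
(* [C^T] and [x] have a single row each, so only [B] contributes to the row index. *)
have -> : cast_ord (esym (mul11n l)) s =
    mxtens_index (mxtens_index (0 : 'I_1, 0 : 'I_1), s) by exact: val_inj.
rewrite 2!sum_mxtens_index.
(* The matrix product sums over the rank index [i] outside and over [h] inside, the opposite of the
   order in [vec]. *)
apply: eq_bigr => j _; rewrite exchange_big mxE mulr_suml; apply: eq_bigr => i _.
rewrite mxE mulr_sumr mulr_suml; apply: eq_bigr => h _.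
rewrite !tensmxE !mxE !mxtens_indexK /= (ord1 o).
by rewrite [_ * B s i]mulrC -!mulrA; congr (_ * _); rewrite mulrC -mulrA.
Qed.

Theorem theorem4p1 (R : realType) (p l M d : nat)
    (hp : (1 <= p)%N) (hl : (1 <= l)%N) (hM : (1 <= M)%N) (hd : (1 <= d)%N)
    (r : nat -> nat) (hr0 : r 0%N = l) (hrd : r d = 1%N)
    (hr : forall i : nat, (1 <= i < d)%N -> (1 <= r i)%N)
    (V : forall i : nat, tensor3 R (r i.-1) (1 + M * p) (r i))
    (u : 'I_p -> int -> R) (y : int -> 'cV[R]_l)
    (hy : forall t : int,
       y t = castmx (hr0, hrd)
               (core_prod V (input_vector M u t)^T (leq0n d)))
    (k : nat) (hk1 : (1 <= k)%N) (hkd : (k <= d)%N) (t : int) :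
  let ut : 'cV[R]_(1 + M * p) := input_vector M u t in
  let vkm1 : 'M[R]_(l, r k.-1) :=
    castmx (hr0, erefl (r k.-1)) (core_prod V ut^T (leq0n k.-1)) in
  let vkp1 : 'cV[R]_(r k) :=
    castmx (erefl (r k), hrd) (core_prod V ut^T hkd) in
  y t = castmx (mul11n l, erefl 1%N)
          ((vkp1^T *t ut^T *t vkm1) *m vec (V k)).
Proof.
move=> ut vkm1 vkp1; rewrite tens_mul_vec hy -/ut /vkm1 /vkp1 {vkm1 vkp1}.
(* Replacing [l] by [r 0] removes the casts along [hr0]. The one along [hrd] stays, as neither side
   is a variable; [castmx_mulr] pushes it onto the right-hand factor. *)
case: k hk1 hkd => // j _ hkd' /=; subst l; rewrite !castmx_id.
rewrite (core_prod_cat _ _ (leq0n j.+1) hkd') castmx_mulr.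
by rewrite (core_prod_recr _ _ (leq0n j)).
Qed.
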